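(* For a second-moment state value $x$ with $y_{k-1}\le x/\Delta\le y_k$ that is to be quantized by stochastic rounding, the corresponding adaptive learning rate $1/\sqrt{\hat x}$ has a variance $$\mathbf{Var}\Big(\frac{1}{\sqrt{\hat x}}\Big)=\mathcal{O}\bigg(\Big(\frac{\Delta}{\sqrt{y_k}}-\frac{\Delta}{\sqrt{y_{k-1}}}\Big)^2\bigg).$$
   Context: In Adam-style optimizers the unsigned second-moment state is used in the denominator to estimate adaptive learning rates, of the form $1/\sqrt{x}$. A state tensor $X$ is quantized to $b$ bits with scale factor $\Delta=\max_{x\in X}|x|$ and monotonic levels $y_0,\dots,y_{2^b-1}$ in $[0,1]$ (unsigned quantization); a stored index $q$ is dequantized to $y_q\cdot\Delta$. For $y_{k-1}\le x/\Delta\le y_k$, stochastic rounding assigns to $x$ the random index $$Q_{sr}(x)=\begin{cases}k-1 & \text{with probability } \dfrac{y_k-x/\Delta}{y_k-y_{k-1}},\\[2mm] k & \text{with probability } \dfrac{x/\Delta-y_{k-1}}{y_k-y_{k-1}},\end{cases}$$ and $\hat x$ denotes the random state value that results from this stochastic rounding of $x$.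
   Formalization: The constant in O(·) depends on a positive lower bound Δ0 of the scale factor Δ, since no constant independent of Δ exists (the ratio of the two sides grows like Δ^{-3} as Δ → 0); y_{k-1} < y_k is assumed so that the rounding probabilities are defined. *)

(* Defs.v *)
From HB Require Import structures.
From mathcomp Require Import all_boot all_order all_algebra.
From mathcomp Require Import all_classical all_reals all_analysis.
Set Implicit Arguments.
Unset Strict Implicit.
Unset Printing Implicit Defensive.
Import Order.TTheory GRing.Theory Num.Theory.
Import numFieldNormedType.Exports.
Local Open Scope classical_set_scope.
Local Open Scope ring_scope.

(* A tensor is a family indexed by a finite type of any shape. *)
Definition scale_factor (R : realType) (I : finType) (X : I -> R) : R :=
  \big[Num.max/0]_(i : I) `|X i|.

(* Only the values of y at indices below 2 ^ b are levels. *)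
Definition unsigned_levels (R : realType) (b : nat) (y : nat -> R) : Prop :=
  (forall j, (j < 2 ^ b)%N -> 0 <= y j <= 1) /\
  (forall i j, (i <= j)%N -> (j < 2 ^ b)%N -> y i <= y j).

(* The two probabilities add up to 1 when y k.-1 < y k, so this determines
   the law of Q. *)
Definition stochastic_rounding (R : realType) (d : measure_display)
    (T : measurableType d) (P : probability T R)
    (Delta : R) (y : nat -> R) (k : nat) (x : R) (Q : {RV P >-> nat}) : Prop :=
  P (Q @^-1` [set k.-1]) = ((y k - x / Delta) / (y k - y k.-1))%:E /\
  P (Q @^-1` [set k]) = ((x / Delta - y k.-1) / (y k - y k.-1))%:E.

Definition dequantize (R : realType) (Delta : R) (y : nat -> R) (q : nat) : R :=
  y q * Delta.

(* Main.v *)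
(* Almost surely 1/sqrt(x^) takes one of the two values 1/sqrt(y_j Delta),
   j = k-1, k, so its variance is at most the squared gap between them, which is
   Delta^-1 (1/sqrt y_k - 1/sqrt y_(k-1))^2. The claimed bound carries Delta^2
   in place of Delta^-1, whence C = Delta0^-3. If y_(k-1) = 0, the convention
   1/0 = 0 applies on both sides and the same identity holds. *)

Require Import Defs.
From HB Require Import structures.
From mathcomp Require Import all_boot all_order all_algebra.
From mathcomp Require Import all_classical all_reals all_analysis.
From mathcomp Require Import measurable_realfun lra.
Import Order.TTheory GRing.Theory Num.Theory.
Import numFieldNormedType.Exports.
Local Open Scope classical_set_scope.
Local Open Scope ring_scope.

Lemma integrable_itv {d} {T : measurableType d} {R : realType}
    (P : probability T R) {X : T -> R} {m M : R} :
  measurable_fun setT X -> (forall w, m <= X w <= M) ->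
  P.-integrable setT (EFin \o X).
Proof.
move=> mX Xb; apply: measurable_bounded_integrable => //.
  by rewrite (le_lt_trans (probability_le1 _ _))// ltry.
exists (`|m| + `|M|); split; first by rewrite num_real.
move=> r hr w _ /=; apply/(le_trans _ (ltW hr)).
have /andP[h1 h2] := Xb w.
rewrite ler_norml; apply/andP; split.
  by have := ler_norm (- m); rewrite normrN; have := normr_ge0 M; lra.
by have := ler_norm M; have := normr_ge0 m; lra.
Qed.

Lemma expectation_itv {d} {T : measurableType d} {R : realType}
    (P : probability T R) {X : T -> R} {m M : R} :
  measurable_fun setT X -> (forall w, m <= X w <= M) ->
  m <= fine ('E_P[X])%E <= M.
Proof.
move=> mX Xb; have iX := integrable_itv P mX Xb.
have EX : 'E_P[X]%E \is a fin_num by rewrite unlock; exact: integrable_fin_num.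
have icst (r : R) : P.-integrable setT (EFin \o cst r).
  by apply: (@integrable_itv _ _ _ _ _ r r) => // w; rewrite /= lexx.
rewrite -!lee_fin fineK// -(expectation_cst P m) -(expectation_cst P M) unlock.
apply/andP; split; apply: le_integral => //; try exact: icst.
  by move=> w _; rewrite lee_fin; have /andP[] := Xb w.
by move=> w _; rewrite lee_fin; have /andP[] := Xb w.
Qed.

(** The mean lies in the same interval as almost all values of [X], so the deviation from it is
    almost surely at most [M - m]. This crude estimate suffices; the sharp factor 1/4 is not
    sought. *)
Lemma variance_itv {d} {T : measurableType d} {R : realType}
    {P : probability T R} {X : T -> R} {m M : R} :
  m <= M -> measurable_fun setT X -> {ae P, forall w, m <= X w <= M} ->
  ('V_P[X] <= ((M - m) ^+ 2)%:E)%E.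
Proof.
move=> mM mX Xb.
(* Clipping turns the almost sure bounds into the pointwise ones that [expectation_itv] asks for,
   and leaves the mean unchanged. *)
pose Y w := Num.max m (Num.min M (X w)).
have mY : measurable_fun setT Y.
  by apply: measurable_maxr => //; apply: measurable_minr.
have Yb w : m <= Y w <= M by rewrite /Y le_max lexx ge_max mM ge_min lexx.
have XY : ('E_P[X] = 'E_P[Y])%E.
  rewrite unlock; apply: ae_eq_integral => //; try exact/measurable_EFinP.
  apply: filterS Xb => w /andP[h1 h2] _.
  by rewrite /Y (min_idPr h2) (max_idPr h1).
rewrite /variance unlock -(expectation_cst P ((M - m) ^+ 2)).
have /andP[c1 c2] := expectation_itv P mY Yb.
apply: expectation_le => //.
- by apply: measurable_funM; apply: measurable_funB.
- by move=> w; rewrite !fctE -expr2 sqr_ge0.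
- by move=> w; rewrite /= sqr_ge0.
apply: filterS Xb => w /andP[h1 h2]; rewrite !fctE /= -expr2 XY.
rewrite -ler_sqrt ?sqr_ge0// !sqrtr_sqr [leRHS]ger0_norm ?subr_ge0//.
by rewrite ler_norml; lra.
Qed.

Lemma ae_of_probability1 {d} {T : measurableType d} {R : realType}
    {P : probability T R} {A : set T} :
  measurable A -> P A = 1%E -> {ae P, forall w, A w}.
Proof.
move=> mA PA; apply/negligibleP; first exact: measurableC.
by rewrite [LHS]probability_setC// PA subee.
Qed.

(** The numerators of the two probabilities telescope to [y k - y k.-1], so the two disjoint events
    exhaust the mass. *)
Lemma stochastic_rounding_ae {R : realType} {d} {T : measurableType d}
    {P : probability T R} {Delta : R} {y : nat -> R} {k : nat} {x : R}
    {Q : {RV P >-> nat}} :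
  (0 < k)%N -> y k.-1 < y k -> stochastic_rounding Delta y k x Q ->
  {ae P, forall w, Q w = k.-1 \/ Q w = k}.
Proof.
move=> k0 yk [P1 P2].
(* Any [A] will do, since the sigma-algebra on [nat] is discrete. *)
have mQ A : measurable (Q @^-1` A).
  by rewrite -[_ @^-1` _]setTI; exact: measurable_funP.
apply: (@ae_of_probability1 _ _ _ P (Q @^-1` [set k.-1] `|` Q @^-1` [set k])).
  exact: measurableU.
rewrite measureU//.
  rewrite [X in (X + _)%E]P1 [X in (_ + X)%E]P2 -EFinD; congr EFin.
  by rewrite -mulrDl subrKA divff// subr_eq0 gt_eqF.
(* Disjointness: truncated predecessor gives [k.-1 = k] only at [k = 0], which [k0] excludes. *)
rewrite -subset0 => w /= [-> /esym kE].
by move: k0; rewrite -ltn_predL -kE ltnn.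
Qed.

Theorem proposition3p4 (R : realType) (Delta0 : R) (hDelta0 : 0 < Delta0) :
  exists2 C : R, 0 < C &
  forall (I : finType) (X : I -> R) (b : nat) (y : nat -> R) (i : I) (k : nat)
    (d : measure_display) (T : measurableType d) (P : probability T R)
    (Q : {RV P >-> nat}),
  let Delta := scale_factor X in
  (forall j, 0 <= X j) ->
  Delta0 <= Delta ->
  unsigned_levels b y ->
  (0 < k < 2 ^ b)%N ->
  y k.-1 < y k ->
  y k.-1 <= X i / Delta <= y k ->
  stochastic_rounding Delta y k (X i) Q ->
  ('V_P[fun w => (1 / Num.sqrt (dequantize Delta y (Q w)))%R]
   <= (C * (Delta / Num.sqrt (y k) - Delta / Num.sqrt (y k.-1)) ^+ 2)%:E)%E.
Proof.
exists (Delta0 ^- 3) => [|I X b y i k d T P Q Delta _ D0D [y01 _]].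
  by rewrite invr_gt0 exprn_gt0.
move=> /andP[k0 kb] yk _ /(stochastic_rounding_ae k0 yk) Qae.
have D0 : 0 < Delta := lt_le_trans hDelta0 D0D.
pose g (j : nat) : R := 1 / Num.sqrt (dequantize Delta y j).
(* The order of the two values is not fixed: [g k.-1] is the larger one if [y k.-1 > 0], but it is 0
   if [y k.-1 = 0]. *)
pose m := Num.min (g k.-1) (g k); pose M := Num.max (g k.-1) (g k).
have mM : m <= M by rewrite /m /M ge_min le_max lexx.
have mg : measurable_fun setT (g \o Q).
  by apply: measurableT_comp => //; move=> _ Y _.
apply: (@le_trans _ _ ((M - m) ^+ 2)%:E).
  apply: variance_itv => //.
  by apply: filterS Qae => w [] ->; rewrite /m /M !(le_max, ge_min) !lexx ?orbT.
rewrite lee_fin.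
have -> : (M - m) ^+ 2 = (g k - g k.-1) ^+ 2.
  by rewrite /m /M; case: (leP (g k.-1) (g k)) => _ //; rewrite -sqrrN opprB.
(* Inversion is multiplicative at 0 too, so a zero level needs no separate case. *)
have gE j : (j < 2 ^ b)%N -> g j = (Num.sqrt (y j))^-1 / Num.sqrt Delta.
  by move=> /y01/andP[yj _]; rewrite /g /dequantize sqrtrM// div1r invfM.
rewrite !gE ?(leq_ltn_trans (leq_pred k) kb)// -mulrBl -mulrBr.
rewrite !exprMn exprVn sqr_sqrtr ?(ltW D0)// mulrA mulrC.
apply: ler_wpM2r; first exact: sqr_ge0.
(* With the common square cancelled, [Delta^-1 <= Delta0^-3 * Delta^2] remains; clearing
   denominators gives [Delta0^3 <= Delta^3]. *)
rewrite mulrC ler_pdivlMr ?exprn_gt0// mulrC ler_pdivrMr// -exprSr.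
by rewrite ler_pXn2r// nnegrE ltW.
Qed.
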